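(* Let $m,n\ge 1$ be integers, $\alpha\in\mathbb R$ and $u\in C_c^{2m}(\mathbb R^n\setminus\{0\})$. Then $$\|\Delta_r^m u\|_\alpha^2=\prod_{\ell=0}^{m-1}A_{\alpha+4\ell}^2\,\|u\|_{\alpha+4m}^2+\sum_{j=0}^{2m-1}C_{j,m,\alpha}\,\big\|R_{\alpha+2j,\,2m-1-j}(u)\big\|_{\alpha+2j}^2,$$ where the (nonnegative) coefficients $C_{j,k,\alpha}$ are defined recursively by $C_{0,0,\alpha}=1$, $C_{j,k,\alpha}=0$ if $j<0$ or $j>2k$, and $$C_{j,k+1,\alpha}=A_{\alpha+4k}^2\,C_{j-2,k,\alpha}+D_{\alpha+4k}\,C_{j-1,k,\alpha}+C_{j,k,\alpha},\qquad 0\le j\le 2k+2,\ k\ge 0.$$ (In particular $C_{2m,m,\alpha}=\prod_{\ell=0}^{m-1}A_{\alpha+4\ell}^2$.)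
   Context: Let $n\ge1$ and write $r=|x|$ for $x\in\mathbb R^n$. For $\beta\in\mathbb R$ and $g$ continuous with compact support in $\mathbb R^n\setminus\{0\}$, set $\|g\|_\beta^2=\int_{\mathbb R^n}|g(x)|^2|x|^{-\beta}\,dx$. Let $\partial_r=\sum_{i=1}^n\frac{x_i}{r}\partial_{x_i}$ and $\Delta_r=\partial_r^2+\frac{n-1}{r}\partial_r$ (the radial Laplacian); $\Delta_r^m$ is its $m$-fold composition. For $\alpha\in\mathbb R$, $T_\alpha f=\partial_r f+\frac{n-2-\alpha}{2r}f$. For an integer $k\ge0$, $R_{\alpha,k}=T_\alpha\circ T_{\alpha+2}\circ\cdots\circ T_{\alpha+2k}$ (composition of $k+1$ operators, so $R_{\alpha,0}=T_\alpha$). For $\beta\in\mathbb R$, $A_\beta=\frac{(n+\beta)(n-4-\beta)}{4}$ and $D_\beta=\frac{(n+\beta)^2+(n-4-\beta)^2}{4}$. *)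

(* Defs.v *)
From HB Require Import structures.
From mathcomp Require Import all_boot all_order all_algebra.
From mathcomp Require Import all_classical all_reals all_analysis.
Set Implicit Arguments. Unset Strict Implicit. Unset Printing Implicit Defensive.
Import Order.TTheory GRing.Theory Num.Theory.
Import numFieldNormedType.Exports.
Local Open Scope classical_set_scope.
Local Open Scope ring_scope.

Section Defs.
Variable R : realType.

Definition enorm (n : nat) (x : 'rV[R]_n) : R :=
  Num.sqrt (\sum_(i < n) x ord0 i ^+ 2).

(* Lebesgue integral over R^n, written as the iterated Lebesgue integral
   (dx_0 outermost).  For continuous compactly supported integrands this is
   the n-dimensional Lebesgue integral (Fubini). *)
Fixpoint iint (n : nat) : ('rV[R]_n -> R) -> R :=
  match n return ('rV[R]_n -> R) -> R with
  | 0 => fun f => f 0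
  | n'.+1 => fun f =>
      Rintegral (@lebesgue_measure R) setT
        (fun t : R => iint (fun y : 'rV[R]_n' =>
           f (row_mx (const_mx t : 'rV[R]_1) y)))
  end.

Definition wnorm2 (n : nat) (beta : R) (g : 'rV[R]_n -> R) : R :=
  iint (fun x => (g x) ^+ 2 * powR (enorm x) (- beta)).

Definition dr (n : nat) (f : 'rV[R]_n -> R) : 'rV[R]_n -> R :=
  fun x => 'D_((enorm x)^-1 *: x) f x.

Definition Lapr (n : nat) (f : 'rV[R]_n -> R) : 'rV[R]_n -> R :=
  fun x => dr (dr f) x + (n%:R - 1) / enorm x * dr f x.

Definition Top (n : nat) (alpha : R) (f : 'rV[R]_n -> R) : 'rV[R]_n -> R :=
  fun x => dr f x + (n%:R - 2 - alpha) / (2 * enorm x) * f x.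

Fixpoint Rop (n : nat) (alpha : R) (k : nat) (f : 'rV[R]_n -> R)
  : 'rV[R]_n -> R :=
  match k with
  | 0 => Top alpha f
  | k'.+1 => Top alpha (Rop (alpha + 2) k' f)
  end.

Definition Acoef (n : nat) (beta : R) : R :=
  (n%:R + beta) * (n%:R - 4 - beta) / 4.
Definition Dcoef (n : nat) (beta : R) : R :=
  ((n%:R + beta) ^+ 2 + (n%:R - 4 - beta) ^+ 2) / 4.

Fixpoint Ccoef (n : nat) (j : int) (k : nat) (alpha : R) : R :=
  match k with
  | 0 => if j == 0%Z then 1 else 0
  | k'.+1 =>
      if (0 <= j)%R && (j <= (2 * k'.+1)%:Z)%R then
        Acoef n (alpha + 4 * k'%:R) ^+ 2 * Ccoef n (j - 2) k' alpha
        + Dcoef n (alpha + 4 * k'%:R) * Ccoef n (j - 1) k' alpha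
        + Ccoef n j k' alpha
      else 0
  end.

Fixpoint Ck (n : nat) (k : nat) (f : 'rV[R]_n -> R) : Prop :=
  match k with
  | 0 => continuous f
  | k'.+1 => (forall x, differentiable f x) /\
             (forall v : 'rV[R]_n, Ck k' (fun x => 'D_v f x))
  end.

Definition Cc_punct (n k : nat) (u : 'rV[R]_n -> R) : Prop :=
  Ck k u /\
  exists K : set 'rV[R]_n, compact K /\ ~ K 0 /\ (forall x, ~ K x -> u x = 0).

End Defs.

(* Main.v *)
Require Import Defs.
From HB Require Import structures.
From mathcomp Require Import all_boot all_order all_algebra.
From mathcomp Require Import all_classical all_reals all_analysis.
From mathcomp Require Import ring lra zify.
Set Implicit Arguments.
Unset Strict Implicit.
Unset Printing Implicit Defensive.
Import Order.TTheory GRing.Theory Num.Theory.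
Import numFieldNormedType.Exports.
Local Open Scope classical_set_scope.
Local Open Scope ring_scope.

(** In terms of the Euler operator [E f x = 'D_x f x], the radial derivative is
    [r^-1 E] and [E (r^a f) = r^a (E + a) f].  Commuting all powers of [r] to the
    left and putting [gam = alpha + 4 m], [L = E + (n - gam) / 2], one finds
    [R_(alpha+2j, 2m-1-j) u = r^-(2m-j) L^(2m-j) u], while [Delta_r^m u] is
    [r^-2m] times the composition, over [beta = alpha + 4 l] with [l < m], of
    [(L + (n + beta) / 2) (L - (n - 4 - beta) / 2)], applied to [u].
    All norms then become norms in [L^2 (r^-gam dx)], where [L] is antisymmetric:
    [|(L + a) f|^2 = |L f|^2 + a^2 |f|^2], and expanding the composition produces
    the recursion for the coefficients [C].
    Antisymmetry amounts to [\int E h = - n \int h] for compactly supported [h],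
    which is the derivative at [t = 1] of [\int h (t x) dx = t^-n \int h]. *)

(** * Compactly supported continuous functions of one variable: integral bound and dilation *)

Section Integral1.
Variable R : realType.
Notation mu := (@lebesgue_measure R).
Implicit Types (phi psi : R -> R) (M B : R).

Lemma restrict_support phi M : (forall t, M < `|t| -> phi t = 0) ->
  phi \_ `[- M, M] = phi.
Proof.
move=> phi0; apply/funext => t; rewrite patchE; case: ifPn => //.
rewrite notin_setE /= in_itv /= -ler_norml => /negP; rewrite -ltNge => Mt.
by rewrite phi0.
Qed.

Lemma Rintegral_support phi M : (forall t, M < `|t| -> phi t = 0) ->
  Rintegral mu setT phi = Rintegral mu `[- M, M] phi.
Proof. by move=> phi0; rewrite [RHS]Rintegral_mkcond restrict_support. Qed.

Lemma integrable_compact_support phi M : continuous phi ->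
  (forall t, M < `|t| -> phi t = 0) -> mu.-integrable setT (EFin \o phi).
Proof.
move=> cphi phi0; rewrite -(restrict_support phi0) -restrict_EFin.
have mI : measurable (`[- M, M]%classic : set R) by [].
apply: (integrable_mkcond (mu := mu) (EFin \o phi) mI).1.
apply: continuous_compact_integrable.
  exact: segment_compact.
exact: continuous_subspaceT.
Qed.

Lemma normr_Rintegral_le phi M B : 0 <= M -> continuous phi ->
  (forall t, M < `|t| -> phi t = 0) -> (forall t, `|phi t| <= B) ->
  `|Rintegral mu setT phi| <= B * (2 * M).
Proof.
move=> M0 cphi phi0 phiB; rewrite (Rintegral_support phi0).
have int psi : continuous psi -> mu.-integrable `[- M, M] (EFin \o psi).
  move=> cpsi; apply: continuous_compact_integrable.
    exact: segment_compact.
  exact: continuous_subspaceT.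
apply: (le_trans (le_normr_Rintegral _ (int _ cphi))) => //.
have cabs : continuous (fun t => `|phi t|).
  by move=> t; apply: continuous_comp; [exact: cphi | exact: norm_continuous].
apply: (@le_trans _ _ (Rintegral mu `[- M, M] (fun=> B))).
  apply: le_Rintegral => //; first exact: int.
  by apply: int => t; exact: cst_continuous.
rewrite Rintegral_cst //= lebesgue_measure_itv /= lte_fin.
case: ifPn => [_|]; first by rewrite -EFinB /= opprK; nra.
(* The formula for the length of an interval splits on [- M < M]; in the degenerate case [M = 0] and
   both sides vanish. *)
rewrite -leNgt => MM; have -> : M = 0 by lra.
by rewrite /= !mulr0.
Qed.

(** Substitution on a bounded window. As [1 <= lam], dilation shrinks the support, which therefore
    stays in [[- M, M]]. *)
Lemma Rintegral_dilate phi M (lam : R) : 0 <= M -> 1 <= lam -> continuous phi ->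
  (forall t, M < `|t| -> phi t = 0) ->
  Rintegral mu setT (fun t => phi (lam * t)) = lam^-1 * Rintegral mu setT phi.
Proof.
move=> M0 lam1 cphi phi0.
have lam0 : 0 < lam by lra.
have phi0' t : lam * M < `|t| -> phi t = 0.
  by move=> h; apply: phi0; apply: le_lt_trans h; rewrite ler_peMl.
have phil0 t : M < `|t| -> phi (lam * t) = 0.
  move=> h; apply: phi0; apply: (lt_le_trans h).
  by rewrite normrM (gtr0_norm lam0) ler_peMl.
(* Different windows are chosen on the two sides: multiplication by [lam] maps [[- M, M]] onto
   [[- (lam * M), lam * M]]. *)
rewrite (Rintegral_support phi0') (Rintegral_support phil0).
have dF : ( *%R lam)^`()%classic = cst lam.
  apply/funext => t; rewrite derive1E.
  have -> : *%R lam = (lam \*: id) :> (R -> R) by [].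
  by rewrite deriveZ // derive_id /= scaler1.
rewrite [in RHS]/Rintegral -mulrN integration_by_substitution_increasing //.
- rewrite dF.
  have int : mu.-integrable `[(- M), M] (EFin \o (fun t => phi (lam * t))).
    apply: continuous_compact_integrable; first exact: segment_compact.
    apply: continuous_subspaceT => t.
    by apply: continuous_comp; [exact: mulrl_continuous | exact: cphi].
  rewrite -/(Rintegral mu `[(- M), M] (fun t => phi (lam * t) * lam)).
  by rewrite RintegralZr // mulrCA mulVf ?gt_eqF // mulr1.
- by rewrite -subr_ge0 opprK addr_ge0.
- by move=> x y _ _ xy; rewrite ltr_pM2l.
- by move=> x _; rewrite dF; exact: cst_continuous.
- by rewrite dF; apply: is_cvg_cst.
- by rewrite dF; apply: is_cvg_cst.
- split=> [x _||].
  + by have -> : *%R lam = (lam \*: id) :> (R -> R) by [].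
  + by apply: cvg_at_right_filter; exact: mulrl_continuous.
  + by apply: cvg_at_left_filter; exact: mulrl_continuous.
- exact: continuous_subspaceT.
Qed.

End Integral1.

(** * Iterated integrals: linearity, bound and behaviour under dilation *)

Section IteratedIntegral.
Variable R : realType.
Notation mu := (@lebesgue_measure R).

(** Slicing preserves this class with the same [M] and [B], which permits induction on the
    dimension. Continuity is uniform so that nearby slices are close in sup norm. *)
Definition boxed n (M B : R) (f : 'rV[R]_n -> R) : Prop :=
  [/\ forall e : R, 0 < e -> exists2 d : R, 0 < d & forall x y : 'rV[R]_n,
        (forall i, `|x ord0 i - y ord0 i| < d) -> `|f x - f y| < e,
      forall (x : 'rV[R]_n) i, M < `|x ord0 i| -> f x = 0
    & forall x : 'rV[R]_n, `|f x| <= B].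

Definition slice n (f : 'rV[R]_n.+1 -> R) (t : R) : 'rV[R]_n -> R :=
  fun y => f (row_mx (const_mx t : 'rV[R]_1) y).

Lemma iintS n (f : 'rV[R]_n.+1 -> R) :
  iint f = Rintegral mu setT (fun t => iint (slice f t)).
Proof. by []. Qed.

Lemma slice_support n M B (f : 'rV[R]_n.+1 -> R) t :
  boxed M B f -> M < `|t| -> slice f t = cst 0.
Proof.
move=> [_ f0 _] Mt; apply/funext => y.
have h : M < `|row_mx (const_mx t : 'rV[R]_1) y ord0 (lshift n ord0)|.
  by rewrite row_mxEl mxE.
exact: f0 h.
Qed.

Lemma row_mx_close n (s t d : R) (x y : 'rV[R]_n) :
  `|s - t| < d -> (forall i, `|x ord0 i - y ord0 i| < d) ->
  forall i, `|row_mx (const_mx s : 'rV[R]_1) x ord0 i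
              - row_mx (const_mx t : 'rV[R]_1) y ord0 i| < d.
Proof.
move=> st xy i; rewrite (mxE row_mx_key) [X in _ - X](mxE row_mx_key).
by case: (fintype.split i) => j; rewrite ?xy // !mxE.
Qed.

Lemma boxed_slice n M B (f : 'rV[R]_n.+1 -> R) t :
  boxed M B f -> boxed M B (slice f t).
Proof.
move=> [fu f0 fB]; split=> [e e0|y i My|y]; last exact: fB.
  have [d d0 fd] := fu _ e0; exists d => // x y xy; apply: fd.
  by apply: row_mx_close => //; rewrite subrr normr0.
have h : M < `|row_mx (const_mx t : 'rV[R]_1) y ord0 (rshift 1 i)|.
  by rewrite row_mxEr.
exact: f0 h.
Qed.

Lemma boxed_lin n M B B' c (f g : 'rV[R]_n -> R) : boxed M B f -> boxed M B' g ->
  boxed M (B + `|c| * B') (fun x => f x + c * g x).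
Proof.
move=> [fu f0 fB] [gu g0 gB]; split=> [e e0|x i Mx|x].
(* The [+ 1] keeps the divisor positive when [c = 0]. *)
- have c0 : 0 < `|c| + 1 by rewrite ltr_wpDl.
  have e2 : 0 < e / 2 by lra.
  have [d d0 fd] := fu _ e2.
  have [d' d'0 gd] := gu _ (divr_gt0 e2 c0).
  exists (Num.min d d') => [|x y xy]; first by rewrite lt_min d0.
  have -> : f x + c * g x - (f y + c * g y) = (f x - f y) + c * (g x - g y).
    by ring.
  apply: (le_lt_trans (ler_normD _ _)); rewrite normrM.
  have fxy : `|f x - f y| < e / 2.
    by apply: fd => i; move: (xy i); rewrite lt_min => /andP[].
  have gxy : `|g x - g y| < e / 2 / (`|c| + 1).
    by apply: gd => i; move: (xy i); rewrite lt_min => /andP[].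
  have : (`|c| + 1) * `|g x - g y| < e / 2 by rewrite mulrC -ltr_pdivlMr.
  have : 0 <= `|g x - g y| by [].
  by nra.
- by rewrite (f0 _ _ Mx) (g0 _ _ Mx) mulr0 addr0.
- apply: (le_trans (ler_normD _ _)); rewrite normrM lerD //.
  by rewrite ler_wpM2l.
Qed.

Lemma boxed_dilate n M B lam (f : 'rV[R]_n -> R) : 1 <= lam -> boxed M B f ->
  boxed M B (fun x => f (lam *: x)).
Proof.
move=> lam1 [fu f0 fB]; have lam0 : 0 < lam by lra.
split=> [e e0|x i Mx|//].
  have [d d0 fd] := fu _ e0; exists (d / lam) => [|x y xy].
    exact: divr_gt0.
  apply: fd => i; rewrite !mxE -mulrBr normrM (gtr0_norm lam0) mulrC.
  by rewrite -ltr_pdivlMr.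
apply: (f0 _ i); rewrite mxE; apply: (lt_le_trans Mx).
by rewrite normrM (gtr0_norm lam0) ler_peMl.
Qed.

Lemma iint_cst0 n : iint (cst 0 : 'rV[R]_n -> R) = 0.
Proof.
elim: n => [//|n IH]; rewrite iintS.
have -> : (fun t => iint (slice (cst 0 : 'rV[R]_n.+1 -> R) t)) = cst 0.
  by apply/funext => t; exact: IH.
by rewrite Rintegral_cst // mul0r.
Qed.

(* Linearity and the bound in dimension [n] give continuity of the slice integrals
   in dimension [n + 1], which linearity in dimension [n + 1] needs in turn. *)
Lemma iint_lin_bound n (M : R) : 0 <= M ->
  (forall (f g : 'rV[R]_n -> R) B B' c, boxed M B f -> boxed M B' g ->
     iint (fun x => f x + c * g x) = iint f + c * iint g)
  /\ (forall (f : 'rV[R]_n -> R) B, boxed M B f -> `|iint f| <= B * (2 * M) ^+ n)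
  /\ (forall (f : 'rV[R]_n.+1 -> R) B, boxed M B f ->
     continuous (fun t => iint (slice f t))).
Proof.
move=> M0.
have cont k :
    (forall (f g : 'rV[R]_k -> R) B B' c, boxed M B f -> boxed M B' g ->
     iint (fun x => f x + c * g x) = iint f + c * iint g) ->
    (forall (f : 'rV[R]_k -> R) B, boxed M B f -> `|iint f| <= B * (2 * M) ^+ k) ->
    forall (f : 'rV[R]_k.+1 -> R) B, boxed M B f ->
     continuous (fun t => iint (slice f t)).
  move=> lin bnd f B fb t.
  apply/cvgrPdist_lt => e e0.
  have P0 : 0 <= (2 * M) ^+ k by rewrite exprn_ge0 // mulr_ge0.
  have P1 : 0 < (2 * M) ^+ k + 1 by rewrite ltr_wpDl.
  have [fu _ _] := fb; have [d d0 fd] := fu _ (divr_gt0 e0 P1).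
  near=> s.
  have -> : iint (slice f t) - iint (slice f s)
      = iint (fun y => slice f t y + (-1) * slice f s y).
    by rewrite (lin _ _ B B (-1)) ?mulN1r //; exact: boxed_slice.
  (* The difference of the two slices is bounded by [e'], hence its integral by
     [e' * (2 * M) ^+ k < e]; the [+ 1] covers a vanishing volume. *)
  set e' := e / ((2 * M) ^+ k + 1).
  have {}bnd := bnd (fun y => slice f t y + (-1) * slice f s y) e'.
  apply: (le_lt_trans (bnd _)).
    have [hu h0 _] :=
      boxed_lin (-1) (boxed_slice t fb) (boxed_slice s fb).
    split=> // y; rewrite mulN1r ltW // fd //.
    apply: row_mx_close => [|i]; last by rewrite subrr normr0.
    by near: s; apply/nbhs_ballP; exists d.
  have : e' * ((2 * M) ^+ k + 1) = e by rewrite /e' divfK ?gt_eqF.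
  have : 0 < e' by rewrite /e' divr_gt0.
  by lra.
suff [lin bnd] : (forall (f g : 'rV[R]_n -> R) B B' c, boxed M B f -> boxed M B' g ->
     iint (fun x => f x + c * g x) = iint f + c * iint g)
  /\ (forall (f : 'rV[R]_n -> R) B, boxed M B f -> `|iint f| <= B * (2 * M) ^+ n).
  by split=> //; split=> //; exact: cont.
elim: n => [|n [lin bnd]].
  by split=> [//|f B [_ _ fB]]; rewrite expr0 mulr1; exact: fB.
have supp0 (f : 'rV[R]_n.+1 -> R) B : boxed M B f ->
    forall t, M < `|t| -> iint (slice f t) = 0.
  by move=> fb t Mt; rewrite (slice_support fb Mt) iint_cst0.
split=> [f g B B' c fb gb|f B fb].
  rewrite !iintS -RintegralZl //; last first.
    exact: integrable_compact_support (cont _ lin bnd _ _ gb) (supp0 _ _ gb).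
  rewrite -RintegralD //.
  - apply: eq_Rintegral => t _.
    by rewrite -(lin _ _ B B') //; exact: boxed_slice.
  - exact: integrable_compact_support (cont _ lin bnd _ _ fb) (supp0 _ _ fb).
  - apply: (@integrable_compact_support _ _ M) => [t|t Mt].
      by apply: cvgMr; exact: (cont _ lin bnd _ _ gb).
    by rewrite (supp0 _ _ gb) // mulr0.
rewrite iintS exprSr mulrA; apply: normr_Rintegral_le => //.
- exact: (cont _ lin bnd _ _ fb).
- exact: supp0 fb.
- by move=> t; apply: bnd; exact: boxed_slice.
Unshelve. all: by end_near. Qed.

Lemma iint_lin n M B B' c (f g : 'rV[R]_n -> R) : 0 <= M ->
  boxed M B f -> boxed M B' g ->
  iint (fun x => f x + c * g x) = iint f + c * iint g.
Proof. by move=> M0; have [h _] := iint_lin_bound n M0; exact: h. Qed.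

Lemma iint_bound n M B (f : 'rV[R]_n -> R) : 0 <= M -> boxed M B f ->
  `|iint f| <= B * (2 * M) ^+ n.
Proof. by move=> M0; have [_ [h _]] := iint_lin_bound n M0; exact: h. Qed.

(** The slice at [t] of the dilated function is the dilate of the slice at [lam * t], so each
    coordinate contributes one factor [lam^-1]. *)
Lemma iint_dilate n M B lam (f : 'rV[R]_n -> R) : 0 <= M -> 1 <= lam ->
  boxed M B f -> iint (fun x => f (lam *: x)) = lam ^- n * iint f.
Proof.
move=> M0 lam1; elim: n f => [|n IH] f fb.
  by rewrite expr0 invr1 mul1r /= scaler0.
have lam0 : lam != 0 by rewrite gt_eqF //; lra.
have [_ [_ cont]] := iint_lin_bound n M0.
rewrite !iintS.
under eq_Rintegral => t _.
  rewrite (_ : slice _ t = fun y => slice f (lam * t) (lam *: y)); last first.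
    apply/funext => y; congr (f _).
    apply: (etrans (scale_row_mx lam (const_mx t : 'rV[R]_1) y)).
    by congr row_mx; apply/matrixP => i j; rewrite !mxE.
  rewrite (IH _ (boxed_slice _ fb)).
  over.
rewrite RintegralZl //; last first.
  apply: (@integrable_compact_support _ (fun t => iint (slice f (lam * t))) M).
    move=> t; apply: (@continuous_comp _ _ _ ( *%R lam) (fun t => iint (slice f t))).
      exact: mulrl_continuous.
    exact: (cont _ _ fb).
  move=> t Mt; rewrite (slice_support fb) ?iint_cst0 //.
  apply: (lt_le_trans Mt); rewrite normrM ler_peMl //.
  by rewrite ger0_norm //; lra.
rewrite (@Rintegral_dilate _ (fun t => iint (slice f t)) M) //.
- by rewrite mulrA exprS invfM [_ * lam^-1]mulrC.
- exact: (cont _ _ fb).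
- by move=> t Mt; rewrite (slice_support fb Mt) iint_cst0.
Qed.

End IteratedIntegral.

(** * The Euler operator and the integral of its values *)

Section Euler.
Variables (R : realType) (n : nat).
Implicit Types (f g h : 'rV[R]_n -> R) (K : set 'rV[R]_n) (x v : 'rV[R]_n).

Lemma coord_le_norm x i : `|x ord0 i| <= `|x|.
Proof.
rewrite [leRHS]/Num.Def.normr /= mx_normrE; apply/bigmax_geP; right => /=.
by exists (ord0, i).
Qed.

(** Heine-Cantor on [K] through the covering form of compactness. If only [y] lies in [K] the two
    points are exchanged; if neither does, both values are zero. *)
Lemma compact_support_unif f K : compact K -> continuous f ->
  (forall x, ~ K x -> f x = 0) ->
  forall e : R, 0 < e -> exists2 d : R, 0 < d & forall x y : 'rV[R]_n,
    (forall i, `|x ord0 i - y ord0 i| < d) -> `|f x - f y| < e.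
Proof.
move=> cK cf f0 e e0.
have : \forall d \near (0:R)^'+, K `<=` (fun x => forall y : 'rV[R]_n,
    (forall i, `|x ord0 i - y ord0 i| < d) -> `|f x - f y| < e).
  move: cK => /compact_near_coveringP.
  apply => x Kx.
  have e2 : 0 < e / 2 by lra.
  have /cvgrPdist_lt /(_ _ e2) /nbhs_ballP [d d0 fd] := cf x.
  exists (ball x (d / 2), [set k : R | k < d / 2]).
    split; first by apply: nbhsx_ballx; rewrite divr_gt0.
    by apply: nbhs_right_lt; rewrite divr_gt0.
  move=> [y k] /= [xy kd] z yz.
  have fxy : `|f x - f y| < e / 2.
    by apply: fd; apply: (le_ball _ xy); rewrite /= in d0; lra.
  have fxz : `|f x - f z| < e / 2.
    apply: fd; split=> // i j; rewrite (ord1 i).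
    have [_ /(_ ord0 j)] := xy; have := yz j; rewrite /ball /= => h1 h2.
    rewrite (_ : x ord0 j - z ord0 j =
      (x ord0 j - y ord0 j) + (y ord0 j - z ord0 j)); last by ring.
    by apply: (le_lt_trans (ler_normD _ _)); lra.
  rewrite (_ : f y - f z = - (f x - f y) + (f x - f z)); last by ring.
  by apply: (le_lt_trans (ler_normD _ _)); rewrite normrN; lra.
move=> nd; near (0:R)^'+ => d.
have d0 : 0 < d by [].
exists d => // x y xy.
have hd : K `<=` (fun x => forall y : 'rV[R]_n,
    (forall i, `|x ord0 i - y ord0 i| < d) -> `|f x - f y| < e) by near: d.
have [Kx|nKx] := pselect (K x); first exact: hd.
have [Ky|nKy] := pselect (K y); last by rewrite !f0 // subrr normr0.
by rewrite distrC; apply: hd => // i; rewrite distrC.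
Unshelve. all: by end_near. Qed.

(** The order of quantifiers matters: one [M] serves every function supported in [K], as linearity
    of [iint] requires a common box. *)
Lemma boxed_compact K : compact K -> exists2 M : R, 0 <= M &
  forall f, continuous f -> (forall x, ~ K x -> f x = 0) ->
    exists B, boxed M B f.
Proof.
move=> cK; have [M [_ HM]] := compact_bounded cK.
exists (`|M| + 1); first by rewrite addr_ge0.
move=> f cf f0.
have : compact (f @` K).
  by apply: continuous_compact => //; exact: continuous_subspaceT.
move=> /compact_bounded [B [_ HB]]; exists (`|B| + 1); split.
- exact: compact_support_unif cK cf f0.
- move=> x i Mx; apply: f0 => Kx.
  have : `|x| <= `|M| + 1 by apply: HM => //; rewrite ltr_pwDr // ler_norm.
  by have := coord_le_norm x i; lra.
- move=> x; have [Kx|/f0 ->] := pselect (K x); last first.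
    by rewrite normr0 addr_ge0.
  by apply: (HB (`|B| + 1)); [rewrite ltr_pwDr // ler_norm | exists x].
Qed.

Lemma is_derive_line f x v (d : R) :
  is_derive x v f d <-> is_derive (0 : R) 1 (fun k : R => f (k *: v + x)) d.
Proof.
have E : (fun k : R => k^-1 *: ((f \o shift x) (k *: v) - f x)) =
  (fun k : R => k^-1 *: (((fun k : R => f (k *: v + x)) \o shift 0) (k *: 1)
     - f (0 *: v + x))).
  by apply/funext => k /=; rewrite addr0 scale0r add0r [_%:A]mulr1.
by split=> -[df <-]; split; rewrite /derivable /derive ?E // -E.
Qed.

(** Scaling the direction is a one-variable chain rule along the line, with no differentiability of
    [f] involved. It converts [dr] into [(enorm x)^-1] times [euler]. *)
Lemma is_derive_dirZ f x v (c d : R) :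
  is_derive x v f d -> is_derive x (c *: v) f (c * d).
Proof.
move=> /is_derive_line fd; apply/is_derive_line.
have -> : (fun k : R => f (k *: (c *: v) + x)) =
    (fun k : R => f (k *: v + x)) \o (fun k : R => k * c).
  by apply/funext => k /=; rewrite scalerA.
rewrite mulrC; apply: is_derive1_comp; first by rewrite mul0r.
have -> : (fun k : R => k * c) = c \*: (id : R -> R).
  by apply/funext => k /=; rewrite mulrC.
by apply: is_derive_eq; rewrite [LHS]mulr1.
Qed.

Definition euler f : 'rV[R]_n -> R := fun x => 'D_x f x.

Lemma is_derive_ray h x (t : R) : t != 0 -> derivable h (t *: x) (t *: x) ->
  is_derive t 1 (fun s => h (s *: x)) (t^-1 * euler h (t *: x)).
Proof.
move=> t0 /derivableP /(is_derive_dirZ t^-1).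
rewrite scalerA mulVf // scale1r -/(euler _ _) => -[df <-].
have E : (fun k : R => k^-1 *: (((fun s : R => h (s *: x)) \o shift t) (k *: 1)
      - h (t *: x))) =
    (fun k : R => k^-1 *: ((h \o shift (t *: x)) (k *: x) - h (t *: x))).
  by apply/funext => k /=; rewrite -scalerDl [_%:A]mulr1.
by split; rewrite /derivable /derive E.
Qed.

Lemma near_off_support f K x : compact K -> (forall x, ~ K x -> f x = 0) ->
  ~ K x -> \forall y \near x, f y = 0.
Proof.
move=> cK f0 nKx.
have : open (~` K).
  by apply: closed_openC; apply: compact_closed cK; exact: norm_hausdorff.
rewrite openE => /(_ x nKx); apply: filterS => y; exact: f0.
Qed.

Lemma euler_off_support f K : compact K -> (forall x, ~ K x -> f x = 0) ->
  forall x, ~ K x -> euler f x = 0.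
Proof.
move=> cK f0 x nKx; rewrite /euler.
rewrite (@near_eq_derive _ _ _ f (cst 0)) ?derive_cst //.
exact: near_off_support nKx.
Qed.

(** The derivative of [t ^- n] at [1], taken from the right since dilations are only considered for
    factors at least [1]. *)
Lemma cvg_exprV_rate :
  (fun e : R => e^-1 * ((1 + e) ^- n - 1)) @ (0:R)^'+ --> (- n%:R : R).
Proof.
apply: cvg_dnbhs_at_right.
have d : is_derive (1:R) 1 (fun x : R => (x ^+ n)^-1) (- n%:R).
  have dX : is_derive (1:R) 1 (fun x : R => x ^+ n) n%:R.
    have -> : (fun x : R => x ^+ n) = id ^+ n.
      by apply/funext => x; rewrite exprfctE.
    by apply: is_derive_eq; rewrite expr1n mulr1 [LHS]mulr1.
  have n0 : (1:R) ^+ n != 0 by rewrite expr1n oner_eq0.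
  split; first exact: (@derivableV _ _ (fun x : R => x ^+ n)).
  rewrite (@deriveV _ _ (fun x : R => x ^+ n)) // derive_val.
  by rewrite !expr1n invr1 scaleN1r.
rewrite (_ : (fun e : R => _) = (fun e : R =>
    e^-1 *: (((fun x : R => (x ^+ n)^-1) \o shift 1) (e *: 1) - (1 ^+ n)^-1))).
  by case: d => dv <-.
by apply/funext => e /=; rewrite [_%:A]mulr1 expr1n invr1 [e + 1]addrC.
Qed.

(** The difference quotient of the dilated integral has two limits, which must agree: [iint_dilate]
    gives the right-hand side, and a first-order expansion of [h] along rays, uniform in [x], gives
    the left. *)
Lemma iint_euler h K : compact K -> (forall x, ~ K x -> h x = 0) ->
  continuous h -> continuous (euler h) -> (forall x, derivable h x x) ->
  iint (euler h) = - n%:R * iint h.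
Proof.
move=> cK h0 ch cEh dh.
have [M M0 boxK] := boxed_compact cK.
have [B hb] := boxK _ ch h0.
have [B' Ehb] := boxK _ cEh (euler_off_support cK h0).
have [Ehu Eh0 EhB] := Ehb.
have B'0 : 0 <= B' by apply: le_trans (EhB 0).
suff lim1 : (fun e : R => e^-1 * ((1 + e) ^- n - 1) * iint h) @ (0:R)^'+
    --> iint (euler h).
  apply: (cvg_unique _ lim1); first exact: norm_hausdorff.
  by apply: cvgMl; exact: cvg_exprV_rate.
apply/cvgrPdist_le => eps eps0.
have P0 : 0 <= (2 * M) ^+ n by rewrite exprn_ge0 // mulr_ge0.
have P1 : 0 < (2 * M) ^+ n + 1 by rewrite ltr_wpDl.
pose eta := eps / ((2 * M) ^+ n + 1).
have eta0 : 0 < eta by rewrite divr_gt0.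
have eta2 : 0 < eta / 2 by lra.
have [d d0 Ehd] := Ehu _ eta2.
near=> e.
have e0 : 0 < e by [].
(* [eM] keeps [c *: x] within [d] of [x] for [c] between [1] and [1 + e]; [eB] makes the error from
   replacing [c^-1] by [1] small. *)
have eM : e * (M + 1) < d.
  rewrite -ltr_pdivlMr; last by lra.
  by near: e; apply: nbhs_right_lt; rewrite divr_gt0 //; lra.
have eB : e * (B' + 1) < eta / 2.
  rewrite -ltr_pdivlMr; last by lra.
  by near: e; apply: nbhs_right_lt; rewrite divr_gt0 //; lra.
have hdil : boxed M B (fun x => h ((1 + e) *: x)).
  by apply: boxed_dilate => //; lra.
have key x : `|h ((1 + e) *: x) - h x - e * euler h x| <= e * eta.
  have [xM|] := pselect (forall i, `|x ord0 i| <= M); last first.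
    move=> /existsNP [i /negP]; rewrite -ltNge => Mx.
    have [_ hs _] := hb; have [_ hs' _] := hdil.
    rewrite (hs _ _ Mx) (Eh0 _ _ Mx) (hs' _ _ Mx) mulr0 !subr0 normr0.
    by rewrite mulr_ge0 // ltW.
  (* The mean value theorem on the ray through [x] yields [e * c^-1 * euler h (c *: x)], which is
     then compared with [e * euler h x]. *)
  have [|t||c] := @MVT _ (fun s => h (s *: x))
      (fun t => t^-1 * euler h (t *: x)) 1 (1 + e).
  - by rewrite ltrDl.
  - rewrite in_itv /= => /andP[t1 _]; apply: is_derive_ray => //.
    by rewrite gt_eqF // (lt_trans _ t1).
  - apply: continuous_subspaceT => s; apply: continuous_comp; last exact: ch.
    exact: scalel_continuous.
  rewrite in_itv /= scale1r => /andP[c1 ce] ->.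
  have c0 : 0 < c by lra.
  rewrite (_ : c^-1 * _ * _ - _ =
    e * ((euler h (c *: x) - euler h x) - (1 - c^-1) * euler h (c *: x)));
    last by ring.
  rewrite normrM gtr0_norm // ler_pM2l //.
  apply: (le_trans (ler_normB _ _)).
  have h1 : `|euler h (c *: x) - euler h x| < eta / 2.
    apply: Ehd => i; rewrite mxE -[X in _ - X]mul1r -mulrBl normrM.
    rewrite gtr0_norm ?subr_gt0 //.
    by have := xM i; have : 0 <= `|x ord0 i| by []; nra.
  have h2 : `|(1 - c^-1) * euler h (c *: x)| <= e * B'.
    rewrite normrM ler_pM //.
    have ci : c * c^-1 = 1 by rewrite mulfV ?gt_eqF.
    have ci0 : 0 < c^-1 by rewrite invr_gt0.
    rewrite ger0_norm; nra.
  lra.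
have hdif := boxed_lin (-1) hdil hb.
have hq := boxed_lin (- e) hdif Ehb.
(* Continuity and support come from [hq]; its crude constant is replaced by the one of [key], which
   is small compared with [e]. *)
have hq' : boxed M (e * eta)
    (fun x => h ((1 + e) *: x) + -1 * h x + - e * euler h x).
  case: hq => q1 q2 _; split=> // x; rewrite mulN1r mulNr; exact: key.
have := iint_bound M0 hq'.
rewrite (iint_lin _ M0 hdif Ehb) (iint_lin _ M0 hdil hb).
rewrite (@iint_dilate _ _ M B) //; last by lra.
set I := iint h; set J := iint _; set p := (1 + e) ^- n => le1.
have le2 : e * eta * (2 * M) ^+ n <= e * eps.
  rewrite -mulrA ler_pM2l //.
  have : eta * ((2 * M) ^+ n + 1) = eps by rewrite /eta divfK ?gt_eqF.
  by nra.
rewrite -(ler_pM2l e0); apply: le_trans le2; apply: le_trans le1.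
rewrite -[X in X * _ <= _](gtr0_norm e0) -normrM.
rewrite (_ : e * _ = - (p * I + -1 * I + - e * J)) ?normrN //.
by field; rewrite gt_eqF.
Unshelve. all: by end_near. Qed.

End Euler.

(** * Stability of the classes [Ck] under the Euler operator *)

Section Regularity.
Variables (R : realType) (n : nat).
Implicit Types (f g : 'rV[R]_n -> R) (x v : 'rV[R]_n).

Lemma CkW k f : Ck k.+1 f -> Ck k f.
Proof.
elim: k f => [|k IH] f /= [df Df].
  by move=> x; exact/differentiable_continuous.
by split=> // v; apply: IH; exact: Df.
Qed.

Lemma Ck_leq k l f : (k <= l)%N -> Ck l f -> Ck k f.
Proof.
move=> /subnKC <-; elim: (l - k)%N => [|d IH]; first by rewrite addn0.
by rewrite addnS => /CkW.
Qed.

Lemma Ck_lin k c f g : Ck k f -> Ck k g -> Ck k (fun x => f x + c * g x).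
Proof.
elim: k f g => [|k IH] f g /=.
  move=> cf cg x; apply: (@continuousD _ _ _ f (fun y => c * g y)).
    exact: cf.
  by apply: (@continuousM _ _ (fun=> c) g); [exact: cst_continuous | exact: cg].
move=> [df Df] [dg Dg].
have dcg x : differentiable (c \*: g) x by apply: differentiableZ.
split=> [x|v].
  exact: (@differentiableD _ _ _ f (c \*: g)).
rewrite (_ : (fun x => _) = fun x => 'D_v f x + c * 'D_v g x); first exact: IH.
apply/funext => x.
rewrite (@deriveD _ _ _ f (c \*: g)) ?deriveZ //; exact: diff_derivable.
Qed.

Lemma is_derive_coord x v i : is_derive x v (fun y : 'rV[R]_n => y ord0 i) (v ord0 i).
Proof.
apply/is_derive_line.
rewrite (_ : (fun k : R => _) = (fun k : R => (v ord0 i \*: id) k + cst (x ord0 i) k)).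
  by apply: is_derive_eq; rewrite addr0 [LHS]mulr1.
by apply/funext => k; rewrite !mxE /= mulrC.
Qed.

Lemma Ck_coordM k i f : Ck k f -> Ck k (fun x => x ord0 i * f x).
Proof.
elim: k f => [|k IH] f.
  move=> cf x; apply: (@continuousM _ _ (fun y : 'rV[R]_n => y ord0 i) f).
    exact: coord_continuous.
  exact: cf.
move=> cf; have [df Df] := cf; split=> [x|v].
  apply: (@differentiableM _ _ (fun y : 'rV[R]_n => y ord0 i) f) => //.
  exact: differentiable_coord.
rewrite (_ : (fun x => _) = fun x => x ord0 i * 'D_v f x + v ord0 i * f x).
  by apply: Ck_lin; [apply: IH; exact: Df | exact: CkW].
apply/funext => x.
have dc := is_derive_coord x v i.
rewrite (@deriveM _ _ (fun y : 'rV[R]_n => y ord0 i) f) //; last first.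
  exact: diff_derivable.
by rewrite derive_val [f x *: _]mulrC.
Qed.

Lemma Ck_cst0 k : Ck k (fun _ : 'rV[R]_n => 0 : R).
Proof.
elim: k => [|k IH] /=; first by move=> x; exact: cst_continuous.
split=> [x|v]; first exact: differentiable_cst.
by rewrite (_ : (fun x => _) = fun=> 0) //; apply/funext => x; rewrite derive_cst.
Qed.

Lemma eulerE f x : differentiable f x ->
  euler f x = \sum_(i < n) x ord0 i * 'D_(delta_mx ord0 i) f x.
Proof.
move=> df; rewrite /euler deriveE //.
transitivity ('d f x (\sum_(i < n) x ord0 i *: delta_mx ord0 i)).
  by rewrite -row_sum_delta.
rewrite linear_sum; apply: eq_bigr => i _; rewrite deriveE //.
exact: linearZ.
Qed.

(** [Ck] speaks of fixed directions, whereas that of [euler] moves with the point; the coordinate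
    expansion [eulerE] reduces the claim to [Ck_coordM] and [Ck_lin]. *)
Lemma Ck_euler k f : Ck k.+1 f -> Ck k (euler f).
Proof.
move=> [df Df].
rewrite (_ : euler f = fun x => \sum_(i < n) x ord0 i * 'D_(delta_mx ord0 i) f x).
  elim: (index_enum _) => [|i s IH].
    by rewrite (_ : (fun x => _) = fun=> 0) //; [exact: Ck_cst0 |
      apply/funext => x; rewrite big_nil].
  rewrite (_ : (fun x => _) = fun x => x ord0 i * 'D_(delta_mx ord0 i) f x
     + 1 * \sum_(j <- s) x ord0 j * 'D_(delta_mx ord0 j) f x).
    by apply: Ck_lin => //; apply: Ck_coordM; exact: Df.
  by apply/funext => x; rewrite big_cons mul1r.
by apply/funext => x; exact: eulerE.
Qed.

End Regularity.

(** * Radial operators expressed through powers of the radius and the Euler operator *)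

Section Radial.
Variables (R : realType) (n : nat) (K : set 'rV[R]_n).
Hypotheses (cK : compact K) (K0 : ~ K 0).
Implicit Types (f g : 'rV[R]_n -> R) (x v : 'rV[R]_n).

Definition CkK k f : Prop := Ck k f /\ forall x, ~ K x -> f x = 0.

Definition eulerD (c : R) f : 'rV[R]_n -> R := fun x => euler f x + c * f x.

(** Functions supported in [K] vanish at the origin, and so does this product, whatever value [powR]
    takes there. *)
Definition rpow (a : R) f : 'rV[R]_n -> R := fun x => enorm x `^ a * f x.

Lemma CkK_leq k l f : (k <= l)%N -> CkK l f -> CkK k f.
Proof. by move=> kl [cf f0]; split=> //; exact: Ck_leq cf. Qed.

Lemma CkK_eulerD k c f : CkK k.+1 f -> CkK k (eulerD c f).
Proof.
move=> [cf f0]; split=> [|x nKx].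
  by apply: Ck_lin; [exact: Ck_euler | exact: CkW].
by rewrite /eulerD (euler_off_support cK f0) // f0 // mulr0 addr0.
Qed.

Lemma CkK_iter_eulerD k l c f : CkK (k + l) f -> CkK l (iter k (eulerD c) f).
Proof.
elim: k l => [//|k IH] l cf; rewrite iterS; apply: CkK_eulerD; apply: IH.
by rewrite addnS -addSn.
Qed.

Lemma eulerD_comm b c f : CkK 2 f ->
  eulerD c (eulerD b f) = eulerD b (eulerD c f).
Proof.
move=> cf; have [[df Df] _] := cf.
(* [euler f] is [eulerD 0 f], so its differentiability follows from the lemma on shifted
   operators. *)
have [[dE _] _] : CkK 1 (eulerD 0 f) by exact: CkK_eulerD.
have {}dE x : differentiable (euler f) x.
  by have := dE x; rewrite (_ : eulerD 0 f = euler f) //;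
    apply/funext => y; rewrite /eulerD mul0r addr0.
have E d x : euler (eulerD d f) x = euler (euler f) x + d * euler f x.
  rewrite {1}/euler (@deriveD _ _ _ (euler f) (d \*: f)).
  - by rewrite deriveZ //; exact: diff_derivable.
  - exact: diff_derivable.
  - by apply: derivableZ; exact: diff_derivable.
by apply/funext => x; rewrite /eulerD -!/(eulerD _ f) !E; ring.
Qed.

Lemma iter_eulerD_comm i b c f : CkK i.+1 f ->
  iter i (eulerD c) (eulerD b f) = eulerD b (iter i (eulerD c) f).
Proof.
elim: i => [//|i IH] cf; rewrite !iterS IH; last exact: CkK_leq cf.
by rewrite eulerD_comm //; apply: CkK_iter_eulerD; rewrite addn2.
Qed.

Lemma eulerDE b c f x : eulerD b f x = eulerD c f x + (b - c) * f x.
Proof. by rewrite /eulerD; ring. Qed.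

Lemma enorm_ge0 x : 0 <= enorm x.
Proof. exact: sqrtr_ge0. Qed.

Lemma enorm_gt0 x : x != 0 -> 0 < enorm x.
Proof.
move=> x0; rewrite sqrtr_gt0 lt_def sumr_ge0 ?andbT; last first.
  by move=> i _; exact: sqr_ge0.
apply: contra x0 => /eqP h; apply/eqP/rowP => i; rewrite mxE.
have /(_ i isT) /eqP := psumr_eq0P (fun i _ => sqr_ge0 (x ord0 i)) h.
by rewrite sqrf_eq0 => /eqP.
Qed.

Lemma enormZ (t : R) x : 0 <= t -> enorm (t *: x) = t * enorm x.
Proof.
move=> t0; rewrite /enorm.
under eq_bigr do rewrite mxE exprMn.
by rewrite -mulr_sumr sqrtrM ?sqr_ge0 // sqrtr_sqr ger0_norm.
Qed.

Lemma enorm_continuous : continuous (@enorm R n).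
Proof.
move=> x; apply: (@continuous_comp _ _ _ (fun y : 'rV[R]_n => \sum_(i < n) y ord0 i ^+ 2)).
  apply: continuous_big => [|i _ y]; first exact: add_continuous.
  apply: (@continuous_comp _ _ _ (fun y : 'rV[R]_n => y ord0 i) (fun t => t ^+ 2)).
    exact: coord_continuous.
  exact: exprn_continuous.
exact: sqrt_continuous.
Qed.

(** Euler's identity for a homogeneous function: at [k *: x + x] the norm is [enorm x * (k + 1)]
    once [k > -1], so only a one-variable power is differentiated. *)
Lemma is_derive_enorm_powR a x : x != 0 ->
  is_derive x x (fun y => enorm y `^ a) (a * enorm x `^ a).
Proof.
move=> x0; have r0 := enorm_gt0 x0; apply/is_derive_line.
apply: (@near_eq_is_derive _ _ _
   ((fun s : R => s `^ a) \o (fun k : R => enorm x * (k + 1)))).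
  near=> k; rewrite /= -{3}[x]scale1r -scalerDl enormZ ?[_ * (k + 1)]mulrC //.
  have : -1 < k by near: k; apply: lt_nbhsr; rewrite oppr_lt0.
  by lra.
have -> : a * enorm x `^ a = (a * (enorm x * (0 + 1)) `^ (a - 1)) * enorm x.
  rewrite add0r mulr1 powRB; last by apply/implyP => _; rewrite gt_eqF.
  by rewrite powRr1 ?enorm_ge0 //; field; rewrite gt_eqF.
apply: is_derive1_comp.
  by apply: is_derive1_powR; rewrite add0r mulr1.
rewrite (_ : (fun k : R => _) = (fun k : R => (enorm x \*: id) k + cst (enorm x) k)).
  by apply: is_derive_eq; rewrite addr0 [LHS]mulr1.
by apply/funext => k /=; rewrite mulrDr mulr1.
Unshelve. all: by end_near. Qed.

Lemma K_neq0 x : K x -> x != 0.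
Proof. by move=> Kx; apply/eqP => x0; apply: K0; rewrite -x0. Qed.

(** Product rule on [K], where [x] is nonzero; off [K], in particular at the origin, the function is
    locally zero. *)
Lemma is_derive_rpow a f x : CkK 1 f ->
  is_derive x x (rpow a f) (rpow a (eulerD a f) x).
Proof.
move=> [[df Df] f0].
have [Kx|nKx] := pselect (K x); last first.
  have -> : rpow a (eulerD a f) x = 0.
    by rewrite /rpow /eulerD (euler_off_support cK f0) // f0 // mulr0 addr0 mulr0.
  apply: (@near_eq_is_derive _ _ _ (cst 0)).
  apply: filterS (near_off_support cK f0 nKx) => y fy.
  by rewrite /rpow fy mulr0.
have dr := is_derive_enorm_powR a (K_neq0 Kx).
have dfx : is_derive x x f (euler f x) by apply/derivableP/diff_derivable.
have [dM DM] := is_deriveM dr dfx; split; first exact: dM.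
by apply: (etrans DM); rewrite /rpow /eulerD /GRing.scale /=; ring.
Qed.

Lemma rpow_continuous a f : continuous f -> (forall x, ~ K x -> f x = 0) ->
  continuous (rpow a f).
Proof.
move=> cf f0 x; have [Kx|nKx] := pselect (K x); last first.
  apply: (@near_cst_continuous _ _ 0).
  apply: filterS (near_off_support cK f0 nKx) => y fy.
  by rewrite /rpow fy mulr0.
apply: (@continuousM _ _ (fun y => enorm y `^ a) f); last exact: cf.
apply: (@continuous_comp _ _ _ (@enorm R n) (fun s => s `^ a)).
  exact: enorm_continuous.
apply/differentiable_continuous/derivable1_diffP/derivable_powR.
by rewrite in_itv /= andbT enorm_gt0 // K_neq0.
Qed.

Lemma rpow0 f : rpow 0 f = f.
Proof. by apply/funext => x; rewrite /rpow powRr0 mul1r. Qed.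

Lemma rpow_divr a f : f 0 = 0 ->
  forall x, (enorm x)^-1 * rpow a f x = rpow (a - 1) f x.
Proof.
move=> f0 x; have [->|x0] := eqVneq x 0; first by rewrite /rpow f0 !mulr0.
rewrite /rpow powRB; last by apply/implyP => _; rewrite gt_eqF ?enorm_gt0.
by rewrite powRr1 ?enorm_ge0 // mulrA [_^-1 * _]mulrC.
Qed.

Lemma CkK_at0 k f : CkK k f -> f 0 = 0.
Proof. by move=> [_ f0]; exact: f0. Qed.

Lemma dr_rpow a f : CkK 1 f -> dr (rpow a f) = rpow (a - 1) (eulerD a f).
Proof.
move=> cf; apply/funext => x; rewrite -rpow_divr; last first.
  exact: CkK_at0 (CkK_eulerD a cf).
by have [_ <-] := is_derive_dirZ (enorm x)^-1 (is_derive_rpow a x cf).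
Qed.

Lemma Top_rpow alpha a f : CkK 1 f ->
  Top alpha (rpow a f) = rpow (a - 1) (eulerD (a + (n%:R - 2 - alpha) / 2) f).
Proof.
move=> cf; apply/funext => x; rewrite /Top dr_rpow // invfM.
rewrite (_ : _ * (_ * (enorm x)^-1) * rpow a f x =
  (n%:R - 2 - alpha) / 2 * ((enorm x)^-1 * rpow a f x)); last by ring.
rewrite rpow_divr; last exact: CkK_at0 cf.
by rewrite /rpow /eulerD; ring.
Qed.

Lemma Lapr_rpow a f : CkK 2 f ->
  Lapr (rpow a f) = rpow (a - 2) (eulerD (a + n%:R - 2) (eulerD a f)).
Proof.
move=> cf; have cf1 : CkK 1 f by exact: CkK_leq cf.
have cE := CkK_eulerD a cf.
apply/funext => x; rewrite /Lapr dr_rpow // dr_rpow // -mulrA rpow_divr; last first.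
  exact: CkK_at0 cE.
rewrite (_ : a - 1 - 1 = a - 2); last by ring.
by rewrite /rpow /eulerD -!/(eulerD _ f); ring.
Qed.

(** All factors share one shift: each further [Top] meets a power of the radius lower by [1], while
    its parameter, lower by [2], raises [(n - 2 - alpha) / 2] by [1]. *)
Lemma Rop_rpow alpha k f : CkK k.+1 f ->
  Rop alpha k f = rpow (- k.+1%:R)
    (iter k.+1 (eulerD ((n%:R - 2 - alpha) / 2 - k%:R)) f).
Proof.
elim: k alpha => [|k IH] alpha cf.
  rewrite -{1}[f]rpow0 /= Top_rpow //; congr (rpow _ (eulerD _ _)); ring.
rewrite [LHS]/= IH; last exact: CkK_leq cf.
rewrite Top_rpow; last by apply: CkK_iter_eulerD; rewrite addn1.
rewrite [in RHS]iterS -[k.+2%:R]natr1 -[k.+1%:R]natr1.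
rewrite (_ : (n%:R - 2 - (alpha + 2)) / 2 - k%:R =
  (n%:R - 2 - alpha) / 2 - (k%:R + 1)); last by field.
congr (rpow _ (eulerD _ _)); ring.
Qed.

Lemma wnorm2_rpow beta a f : f 0 = 0 ->
  wnorm2 beta (rpow a f) = wnorm2 (beta - 2 * a) f.
Proof.
move=> f0; congr iint; apply/funext => x.
have [->|x0] := eqVneq x 0; first by rewrite /rpow f0 mulr0 expr0n /= !mul0r.
have x1 : enorm x != 0 by rewrite gt_eqF // enorm_gt0.
rewrite /rpow (_ : - (beta - 2 * a) = - beta + (a + a)); last by ring.
by rewrite !powRD ?x1 ?implybT //; ring.
Qed.

End Radial.

(** * Weighted norms of products of shifted Euler operators *)

Section Norms.
Variables (R : realType) (n : nat) (K : set 'rV[R]_n).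
Hypotheses (cK : compact K) (K0 : ~ K 0).
Implicit Types (f g : 'rV[R]_n -> R).

(** Expanding the square leaves the cross term [2 * b * iint q]. The shift [(n - gam) / 2] is the
    one for which [euler h = 2 * q - n * h], and [iint_euler] then forces [iint q = 0]. *)
Lemma wnorm2_eulerD (gam b : R) f : CkK K 1 f ->
  wnorm2 gam (eulerD ((n%:R - gam) / 2 + b) f) =
  wnorm2 gam (eulerD ((n%:R - gam) / 2) f) + b ^+ 2 * wnorm2 gam f.
Proof.
move=> cf; set c := (n%:R - gam) / 2; have [[df _] f0] := cf.
have [cg g0] := CkK_eulerD cK c cf; set g := eulerD c f in cg g0 *.
have cf0 : continuous f by case: (CkK_leq (leqnSn 0) cf).
have [M M0 boxK] := boxed_compact cK.
have box (F G : 'rV[R]_n -> R) : continuous F -> continuous G -> (forall x, ~ K x -> F x = 0) ->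
    continuous (rpow (- gam) (fun x => F x * G x)) /\
    exists B, boxed M B (rpow (- gam) (fun x => F x * G x)).
  move=> cF cG F0.
  have FG0 x : ~ K x -> F x * G x = 0 by move=> nKx; rewrite F0 // mul0r.
  have cFG : continuous (rpow (- gam) (fun x => F x * G x)).
    apply: (rpow_continuous cK K0) => //.
    by move=> x; apply: (@continuousM _ _ F G); [exact: cF | exact: cG].
  by split=> //; apply: boxK => // x nKx; rewrite /rpow FG0 // mulr0.
have [ch [Bh bh]] := box _ _ cf0 cf0 f0.
have [cq [Bq bq]] := box _ _ cf0 cg f0.
have [_ [Bp bp]] := box _ _ cg cg g0.
set h := rpow _ _ in ch bh; set q := rpow _ _ in cq bq; set p := rpow _ _ in bp.
have dh x : is_derive x x h (2 * q x + - n%:R * h x).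
  have dfx : is_derive x x f (euler f x) by apply/derivableP/diff_derivable.
  have [dM DM] := is_deriveM (is_derive_rpow cK K0 (- gam) x cf) dfx.
  (* Attaching the weight to one factor makes [is_derive_rpow] and the product rule applicable. *)
  have -> : h = rpow (- gam) f * f.
    by apply/funext => y; rewrite /h /rpow fctE mulrA.
  split; first exact: dM.
  apply: (etrans DM).
  by rewrite /h /q /g /rpow /eulerD /c fctE /GRing.scale /=; field.
have Eh : euler h = fun x => 2 * q x + - n%:R * h x.
  by apply/funext => x; have [_ <-] := dh x.
have bq2 : boxed M (0 + `|2| * Bq) (fun x => 2 * q x).
  have -> : (fun x => 2 * q x) = (fun x => cst 0 x + 2 * q x).
    by apply/funext => x; rewrite add0r.
  apply: boxed_lin => //; split=> [e e0|//|x]; last by rewrite normr0.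
  by exists 1 => // x y _; rewrite subrr normr0.
have iq : iint q = 0.
  have : iint (euler h) = - n%:R * iint h.
    apply: (iint_euler cK) => // [x nKx|].
      by rewrite /h /rpow f0 // !mulr0.
    rewrite Eh => x; apply: (@continuousD _ _ _ (2 \*: q) (- n%:R \*: h)).
      by apply: continuousZl_tmp; exact: cq.
    by apply: continuousZl_tmp; exact: ch.
  rewrite Eh (iint_lin _ M0 bq2 bh).
  have -> : iint (fun x => 2 * q x) = 2 * iint q.
    have -> : (fun x => 2 * q x) = (fun x => q x + 1 * q x).
      by apply/funext => x; ring.
    by rewrite (iint_lin _ M0 bq bq); ring.
  by lra.
have bpq := boxed_lin (2 * b) bp bq.
have -> : wnorm2 gam g = iint p.
  by congr iint; apply/funext => x; rewrite /p /rpow mulrC.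
have -> : wnorm2 gam f = iint h.
  by congr iint; apply/funext => x; rewrite /h /rpow mulrC.
have -> : wnorm2 gam (eulerD (c + b) f) =
    iint (fun x => p x + 2 * b * q x + b ^+ 2 * h x).
  congr iint; apply/funext => x; rewrite (eulerDE _ c) -/g /p /q /h /rpow.
  by ring.
by rewrite (iint_lin _ M0 bpq bh) (iint_lin _ M0 bp bq) iq; ring.
Qed.

(** [wnorm2_eulerD] removes the outer shift [a], then, after commuting, the inner shift [- b]; only
    squares of the shifts survive. *)
Lemma wnorm2_eulerD2 (gam a b : R) f : CkK K 2 f ->
  let c := (n%:R - gam) / 2 in
  wnorm2 gam (eulerD (c + a) (eulerD (c - b) f)) =
    wnorm2 gam (eulerD c (eulerD c f))
    + (a ^+ 2 + b ^+ 2) * wnorm2 gam (eulerD c f)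
    + (a * b) ^+ 2 * wnorm2 gam f.
Proof.
move=> cf c; have cf1 : CkK K 1 f by exact: CkK_leq cf.
rewrite wnorm2_eulerD; last exact: CkK_eulerD.
rewrite -/c (eulerD_comm cK) // !wnorm2_eulerD //; last exact: CkK_eulerD.
by rewrite -/c; ring.
Qed.

(** The pair with the largest [beta] acts first. Passing to [k.+1] thus adds an innermost pair,
    whose [beta] is the one in the recursion step of [Ccoef]. *)
Fixpoint eulerQ (c alpha : R) k f : 'rV[R]_n -> R :=
  match k with
  | 0 => f
  | k'.+1 => let beta := alpha + 4 * k'%:R in
      eulerQ c alpha k' (eulerD (c + (n%:R + beta) / 2)
        (eulerD (c - (n%:R - 4 - beta) / 2) f))
  end.

Lemma CkK_eulerQ c alpha k l f : CkK K (2 * k + l) f ->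
  CkK K l (eulerQ c alpha k f).
Proof.
elim: k f => [//|k IH] f cf; apply: IH.
by do 2 apply: (CkK_eulerD cK); apply: CkK_leq cf; lia.
Qed.

(* The exponents decrease from [2 k - 2 m] to [- 2 m]; the shifts in [eulerQ]
   are those produced by commuting the Euler operator with these powers. *)
Lemma iter_Lapr_rpow alpha m k f : CkK K (2 * k) f ->
  iter k (@Lapr R n) (rpow (2 * k%:R - 2 * m%:R) f) =
  rpow (- (2 * m%:R)) (eulerQ ((n%:R - (alpha + 4 * m%:R)) / 2) alpha k f).
Proof.
elim: k f => [|k IH] f cf; first by rewrite mulr0 sub0r.
rewrite iterSr (Lapr_rpow cK K0); last by apply: CkK_leq cf; lia.
rewrite -[k.+1%:R]natr1 (_ : 2 * (k%:R + 1) - 2 * m%:R - 2 = 2 * k%:R - 2 * m%:R :> R);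
  last by ring.
rewrite IH; last by do 2 apply: (CkK_eulerD cK); apply: CkK_leq cf; lia.
rewrite [in RHS]/=; set c := (n%:R - _) / 2.
rewrite (_ : c + _ = 2 * (k%:R + 1) - 2 * m%:R + n%:R - 2); last first.
  by rewrite /c; field.
rewrite (_ : c - _ = 2 * (k%:R + 1) - 2 * m%:R) //.
by rewrite /c; field.
Qed.

(** * The recursive coefficients and the expansion of the norm *)

Lemma Ccoef_out (j : int) k alpha : (j < 0) || ((2 * k)%:Z < j) ->
  Ccoef n j k alpha = 0 :> R.
Proof.
case: k => [|k] /= jk; first by rewrite ifF //; apply/eqP; lia.
by rewrite ifF //; apply/negbTE; lia.
Qed.

Lemma CcoefS (j : int) k alpha : (0 <= j) && (j <= (2 * k.+1)%:Z) ->
  Ccoef n j k.+1 alpha =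
    Acoef n (alpha + 4 * k%:R) ^+ 2 * Ccoef n (j - 2) k alpha
    + Dcoef n (alpha + 4 * k%:R) * Ccoef n (j - 1) k alpha
    + Ccoef n j k alpha :> R.
Proof. by move=> jk; rewrite /= jk. Qed.

(** At the last index only the first term of the recursion remains, the other two indices exceeding
    [2 * k]. *)
Lemma Ccoef_top k alpha : Ccoef n (2 * k)%:Z k alpha =
  \prod_(l < k) Acoef n (alpha + 4 * l%:R) ^+ 2 :> R.
Proof.
elim: k => [|k IH]; first by rewrite big_ord0.
rewrite CcoefS; last by lia.
rewrite (Ccoef_out (j := (2 * k.+1)%:Z)); last by lia.
rewrite (Ccoef_out (j := (2 * k.+1)%:Z - 1)); last by lia.
rewrite (_ : (2 * k.+1)%:Z - 2 = (2 * k)%:Z); last by lia.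
by rewrite IH mulr0 !addr0 big_ord_recr mulrC.
Qed.

(** With [s i] read as [X ^ i], the generating polynomial of the coefficients is multiplied by
    [X ^ 2 + D * X + A ^ 2]. *)
Lemma sum_CcoefS (s : nat -> R) k alpha :
  \sum_(j < (2 * k.+1).+1) Ccoef n j%:Z k.+1 alpha * s (2 * k.+1 - j)%N =
  \sum_(j < (2 * k).+1) Ccoef n j%:Z k alpha *
    (s (2 * k - j).+2 + Dcoef n (alpha + 4 * k%:R) * s (2 * k - j).+1
     + Acoef n (alpha + 4 * k%:R) ^+ 2 * s (2 * k - j)%N).
Proof.
set A := Acoef _ _; set D := Dcoef _ _.
pose C (i : int) : R := Ccoef n i k alpha.
have C0 (i : int) : (i < 0) || ((2 * k)%:Z < i) -> C i = 0 by exact: Ccoef_out.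
transitivity (\sum_(j < (2 * k).+3) (A ^+ 2 * (C (j%:Z - 2) * s ((2 * k).+2 - j)%N)
    + (D * (C (j%:Z - 1) * s ((2 * k).+2 - j)%N)
       + C j%:Z * s ((2 * k).+2 - j)%N))).
  rewrite (_ : (2 * k.+1)%N = (2 * k).+2); last by lia.
  apply: eq_bigr => j _; rewrite CcoefS; last by case: j => /= j; lia.
  by rewrite -/A -/D -!/(C _); ring.
rewrite !big_split /= -!mulr_sumr.
(* Each of the three shifted sums has two terms too many, with zero coefficients: at the top, at
   both ends and at the bottom respectively. *)
have -> : \sum_(j < (2 * k).+3) C j%:Z * s ((2 * k).+2 - j)%N =
    \sum_(j < (2 * k).+1) C j%:Z * s (2 * k - j).+2.
  rewrite 2!big_ord_recr /= !C0 ?mul0r ?addr0; try by rewrite /bump /=; lia.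
  apply: eq_bigr => -[j jk] _ /=; congr (_ * s _); lia.
have -> : \sum_(j < (2 * k).+3) C (j%:Z - 1) * s ((2 * k).+2 - j)%N =
    \sum_(j < (2 * k).+1) C j%:Z * s (2 * k - j).+1.
  rewrite big_ord_recl big_ord_recr /= !C0 ?mul0r ?addr0 ?add0r; try by rewrite /bump /=; lia.
  apply: eq_bigr => -[j jk] _; rewrite /= /bump /=; congr (C _ * s _); lia.
have -> : \sum_(j < (2 * k).+3) C (j%:Z - 2) * s ((2 * k).+2 - j)%N =
    \sum_(j < (2 * k).+1) C j%:Z * s (2 * k - j)%N.
  rewrite 2!big_ord_recl /= !C0 ?mul0r ?add0r; try by rewrite /bump /=; lia.
  apply: eq_bigr => -[j jk] _; rewrite /= /bump /=; congr (C _ * s _); lia.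
rewrite !mulr_sumr -!big_split /=; apply: eq_bigr => j _; rewrite -/(C _); ring.
Qed.

(** Induction with [f] varying: the innermost pair commutes past the powers of [eulerD c],
    [wnorm2_eulerD2] splits each norm in three, and [sum_CcoefS] collects the terms. *)
Lemma wnorm2_eulerQ gam alpha k f : CkK K (2 * k) f ->
  let c := (n%:R - gam) / 2 in
  wnorm2 gam (eulerQ c alpha k f) =
  \sum_(j < (2 * k).+1) Ccoef n j%:Z k alpha
     * wnorm2 gam (iter (2 * k - j) (eulerD c) f).
Proof.
move=> + c; elim: k f => [|k IH] f cf; first by rewrite big_ord1 mul1r.
rewrite (@sum_CcoefS (fun i => wnorm2 gam (iter i (eulerD c) f))) /= IH; last first.
  by do 2 apply: (CkK_eulerD cK); apply: CkK_leq cf; lia.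
apply: eq_bigr => -[j jk] _ /=; congr (_ * _).
have cfi : CkK K (2 * k - j).+2 f by apply: CkK_leq cf; lia.
rewrite (iter_eulerD_comm cK); last exact: (CkK_eulerD cK).
rewrite (iter_eulerD_comm cK); last by apply: CkK_leq cfi.
rewrite wnorm2_eulerD2; last first.
  by apply: (CkK_iter_eulerD cK); rewrite addn2.
(* With [a = (n + beta) / 2] and [b = (n - 4 - beta) / 2], [Dcoef] is [a ^+ 2 + b ^+ 2] and [Acoef]
   is [a * b]. *)
rewrite -/c; congr (_ + _ * _ + _ * _).
  by rewrite /Dcoef; field.
by rewrite /Acoef; field.
Qed.

End Norms.

Theorem theorem1p1 (R : realType) (n m : nat) (hn : (1 <= n)%N) (hm : (1 <= m)%N)
  (alpha : R) (u : 'rV[R]_n -> R) (hu : Cc_punct (2 * m) u) :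
  wnorm2 alpha (iter m (@Lapr R n) u) =
    (\prod_(l < m) Acoef n (alpha + 4 * l%:R) ^+ 2) * wnorm2 (alpha + 4 * m%:R) u
    + \sum_(j < 2 * m) Ccoef n j%:Z m alpha
        * wnorm2 (alpha + 2 * j%:R) (Rop (alpha + 2 * j%:R) (2 * m - 1 - j) u).
Proof.
have [cu [K [cK [K0 u0]]]] := hu.
have cuK : CkK K (2 * m) u by [].
set gam := alpha + 4 * m%:R.
(* For [k = m] the initial power of the radius is [0], so the formula applies to [u] itself. *)
have := @iter_Lapr_rpow _ _ _ cK K0 alpha m m u cuK.
rewrite subrr rpow0 => ->; rewrite -/gam.
rewrite wnorm2_rpow; last first.
  by apply: (CkK_at0 K0 (k := 0)); apply: (CkK_eulerQ cK); rewrite addn0.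
rewrite (_ : alpha - 2 * - (2 * m%:R) = gam); last by rewrite /gam; ring.
(* The index [2 * m] carries no Euler factor: it gives the norm of [u], with the product as
   coefficient. *)
rewrite (wnorm2_eulerQ cK K0) // big_ord_recr /= subnn -Ccoef_top addrC.
congr (_ + _); apply: eq_bigr => -[j jm] _ /=; congr (_ * _).
rewrite (Rop_rpow cK K0); last by apply: CkK_leq cuK; lia.
rewrite (_ : (2 * m - 1 - j).+1 = (2 * m - j)%N); last by lia.
rewrite wnorm2_rpow; last first.
  apply: (CkK_at0 K0 (k := 0)); apply: (CkK_iter_eulerD cK).
  by rewrite addn0; apply: CkK_leq cuK; lia.
have E : (2 * m - j)%:R = 2 * m%:R - j%:R :> R by rewrite natrB 1?ltnW // natrM.
have E1 : (2 * m - 1 - j)%:R = 2 * m%:R - 1 - j%:R :> R.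
  rewrite -subnDA natrB; last by lia.
  by rewrite natrD natrM; ring.
(* Here [j] cancels: the weight becomes [gam] and the shift [(n - gam) / 2] for every term. *)
congr (wnorm2 _ (iter _ (eulerD _) _)); first by rewrite E /gam; ring.
by rewrite E1 /gam; field.
Qed.
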